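(* Let $(X, d, \mu)$ be a geometrically doubling metric measure space with doubling constant $D$, and let $M$ be the maximum cardinality of any $r$-net in $B(x, r)$, where the maximum is taken over all $x \in X$ and all $r > 0$. Then for every $s > 0$, $$\|A_s\|_{L^1(\mu)\to L^1(\mu)} \le M \le D.$$ Moreover, for every $s>0$, $\|A_s\|_{L^\infty(\mu)\to L^\infty(\mu)} = 1$, and for every $1 < p < \infty$, $\|A_s\|_{L^p(\mu)\to L^p(\mu)} \le M^{1/p}$.
   Context: Balls: in a metric space $(X,d)$, $B^{o}(x,r) = \{y\in X: d(x,y)<r\}$ and $B^{cl}(x,r)=\{y\in X: d(x,y)\le r\}$. The notation $B(x,r)$ means that all balls under consideration (in the definitions of $A_s$, $D$ and $M$) are of the same kind: either all open or all closed; the claim is made in both cases. Metric measure space: a Borel measure $\mu$ on $X$ is $\tau$-additive if for every collection $\{U_\alpha:\alpha\in\Lambda\}$ of open sets, $\mu(\cup_\alpha U_\alpha)=\sup_{\mathcal F}\mu(\cup_{i=1}^n U_{\alpha_i})$, the supremum being over all finite subcollections $\mathcal F=\{U_{\alpha_1},\dots,U_{\alpha_n}\}$. $(X,d,\mu)$ is a metric measure space if $\mu$ is a $\tau$-additive Borel measure on the metric space $(X,d)$ which assigns finite measure to bounded Borel sets; $\mu$ is always assumed not identically $0$. The support of $\mu$ is the complement of $\bigcup\{B^{o}(x,r): x\in X,\ \mu B^{o}(x,r)=0\}$; by $\tau$-additivity $\mu(X\setminus\operatorname{supp}\mu)=0$. Averaging operator: for $r>0$, $g$ locally integrable and $x\in\operatorname{supp}\mu$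 (hence for almost every $x$), $A_r g(x)=A_{r,\mu}g(x):=\frac{1}{\mu(B(x,r))}\int_{B(x,r)} g\,d\mu$. $\|A_s\|_{L^p(\mu)\to L^p(\mu)}$ is the operator norm. Nets: a strict (resp. non-strict) $r$-net is a subset $S\subset X$ such that $d(x,y)>r$ (resp. $d(x,y)\ge r$) for any pair of distinct points $x,y\in S$. Convention: $r$-nets are strict when working with closed balls and non-strict when working with open balls. An $r$-net in $B(x,r)$ is an $r$-net contained in $B(x,r)$. Geometrically doubling: there is a positive integer $D$ such that every ball of radius $r$ can be covered with no more than $D$ balls of radius $r/2$ (for all $r>0$); the smallest such $D$ is the doubling constant. *)

(* Defs.v *)
From HB Require Import structures.
From mathcomp Require Import all_boot all_order all_algebra.
From mathcomp Require Import all_classical all_reals all_analysis.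

Set Implicit Arguments.
Unset Strict Implicit.
Unset Printing Implicit Defensive.
Import Order.TTheory GRing.Theory Num.Theory.
Import numFieldNormedType.Exports.
Local Open Scope classical_set_scope.
Local Open Scope ring_scope.

(* The library's measurable types are pointed. A space carrying a nonzero
   measure is nonempty, so working with pointed metric spaces is harmless. *)
#[short(type="pmetricType")]
HB.structure Definition PMetric (R : numDomainType) :=
  {X of Metric R X & Pointed X}.

Notation borel X := (g_sigma_algebraType (@open X)).

Inductive ball_kind := OpenBalls | ClosedBalls.

Section metric.
Context {R : realType} {X : pmetricType R}.
Implicit Types (k : ball_kind) (x : X) (r : R) (S : set X).

(* The library's closed_ball is the closure of the open ball, which can be
   smaller than the set of points at distance at most r. *)
Definition mball k x r : set X :=
  match k with
  | OpenBalls => ball x r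
  | ClosedBalls => [set y | mdist x y <= r]
  end.

(* Nets are strict for closed balls and non-strict for open balls. *)
Definition is_net k r S : Prop :=
  forall x y, S x -> S y -> x <> y ->
    match k with
    | OpenBalls => r <= mdist x y
    | ClosedBalls => r < mdist x y
    end.

Definition metric_bounded S : Prop := exists x r, S `<=` ball x r.

End metric.

Section doubling.
Context {R : realType}.
Implicit Types (X : pmetricType R) (k : ball_kind).

Definition doubling_bound X k (D : nat) : Prop :=
  (0 < D)%N /\
  forall (x : X) (r : R), 0 < r ->
    exists2 C : seq X, (size C <= D)%N &
      mball k x r `<=` \bigcup_(c in [set` C]) mball k c (r / 2).

Definition geometrically_doubling X k : Prop :=
  exists D, doubling_bound X k D.

Definition is_doubling_constant X k (D : nat) : Prop :=
  doubling_bound X k D /\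
  forall D' : nat, doubling_bound X k D' -> (D <= D')%N.

Definition net_in_ball X k (S : set X) : Prop :=
  exists (x : X) (r : R), [/\ 0 < r, is_net k r S & S `<=` mball k x r].

Definition is_max_net_card X k (M : nat) : Prop :=
  (exists2 S : set X, net_in_ball k S & (S #= `I_M)%card) /\
  forall S : set X, net_in_ball k S -> (S #<= `I_M)%card.

End doubling.

Section metric_measure.
Context {R : realType} {X : pmetricType R}.
Variable mu : {measure set (borel X) -> \bar R}.
Local Open Scope ereal_scope.

Definition tau_additive : Prop :=
  forall F : set (set X), F `<=` open ->
    mu (\bigcup_(U in F) U) =
    ereal_sup [set mu (\bigcup_(U in G) U) |
                 G in [set G : set (set X) | finite_set G /\ G `<=` F]].

Definition is_metric_measure : Prop :=
  [/\ tau_additive,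
      forall A : set (borel X),
        measurable A -> metric_bounded (A : set X) -> mu A < +oo &
      exists2 A : set (borel X), measurable A & mu A != 0].

Definition msupport : set X :=
  ~` [set y | exists (x : X) (r : R), mu (ball x r) = 0 /\ ball x r y].

(* Set to 0 off the support of mu, which is a null set when mu is
   tau-additive. *)
Definition averaging (k : ball_kind) (r : R) (g : borel X -> R) :
    borel X -> R :=
  fun x : X =>
    if x \in msupport
    then ((fine (mu (mball k x r)))^-1 * \int[mu]_(y in mball k x r) g y)%R
    else 0%R.

End metric_measure.

(* The norm of A as an operator on L^p(mu); it is +oo unless A maps L^p(mu)
   to itself (measurability included) and is bounded there. *)
Definition op_norm d (T : measurableType d) (R : realType)
    (mu : {measure set T -> \bar R}) (p : \bar R)
    (A : (T -> R) -> (T -> R)) : \bar R :=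
  ereal_inf [set C%:E | C in [set C : R | 0 <= C /\
    forall f : T -> R, f \in Lfun mu p ->
      A f \in Lfun mu p /\
      ('N[mu]_p[EFin \o A f] <= C%:E * 'N[mu]_p[EFin \o f])%E]].

(* Main.v *)
From HB Require Import structures.
Require Import Defs.
From mathcomp Require Import all_boot all_order all_algebra.
From mathcomp Require Import all_classical all_reals all_analysis.
From mathcomp Require Import measurable_realfun ess_sup_inf.
From mathcomp Require Import ring lra.
Set Implicit Arguments.
Unset Strict Implicit.
Unset Printing Implicit Defensive.
Import Order.TTheory GRing.Theory Num.Theory.
Import numFieldNormedType.Exports.
Local Open Scope classical_set_scope.
Local Open Scope ring_scope.

(** Why the bounds hold. A ball of half the radius contains at most one point of
    a net, so a net in a ball has at most as many points as there are balls in a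
    doubling cover; this bounds the sizes of such nets, and gives [M <= D].

    Write [m x] for the mass of the ball [B(x, s)]. By Jensen's inequality on each
    ball ([averaging_powR_le]), [|A_s f| ^ p] is at most the integral of
    [|f| ^ p] against the kernel [K (x, y) = (m x)^-1] for [x] in the support and
    [d(x, y)] within [s], and [0] otherwise. By Tonelli ([schur_test]), the L^p
    bounds for all finite [p >= 1] follow at once from

      [\int K (x, y) dx <= M] for every [y]   ([integral_avg_kernel_le]),

    which is the heart of the matter. Among the points of the support in
    [B(y, s)] choose [c] with [m c] minimal up to a factor [a > 1], discard
    [B(c, s)], and repeat ([greedy_net]). The points chosen form an [s]-net in
    [B(y, s)], hence there are at most [M] of them. On the part of [B(c, s)]
    not discarded earlier [(m x)^-1 <= a / m c], so this part contributes at most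
    [a] to the integral. Let [a] tend to [1]. An almost minimal [c] exists because
    [m] is bounded away from [0] on [B(y, s)] within the support
    ([ball_mass_lower_bound]), by total boundedness.

    Tonelli needs the relation [d(x, y) < s] to be measurable for the product of
    the Borel sigma-algebras; this comes from separability, another consequence of
    doubling ([measurable_mdist_lt]).

    On L^oo, an average of [f] never exceeds the essential supremum of [f], and
    the constant [1] is sent to [1] on the support, whose complement is null by
    tau-additivity ([measure_setC_msupport]). *)

(** * Balls, nets and the doubling property *)

Section metric.
Context {R : realType} {X : pmetricType R}.
Implicit Types (k : ball_kind) (x y c : X) (r e : R) (S : set X).

Lemma ball_mball k x r : ball x r `<=` mball k x r.
Proof. by case: k => // y; rewrite ballEmdist /= => /ltW. Qed.

Lemma mball_ball k x r e : r < e -> mball k x r `<=` ball x e.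
Proof.
move=> re; case: k => /= y; rewrite ?ballEmdist /=; first by move/lt_trans; apply.
by move/le_lt_trans; apply.
Qed.

Lemma mball_center k x r : 0 < r -> mball k x r x.
Proof. by move=> r0; apply: ball_mball; rewrite ballEmdist /= mdistxx. Qed.

Lemma mball_sym k x y r : mball k x r y = mball k y r x.
Proof. by case: k; rewrite /= ?ballEmdist /= metric_sym. Qed.

Lemma open_mdist_ball x r : open (ball x r).
Proof.
rewrite openE => y; rewrite ballEmdist /= => xy.
apply/(@nbhs_ballP _ X); exists (r - mdist x y); first by rewrite /= subr_gt0.
move=> z; rewrite !ballEmdist /= ltrBrDl; apply: le_lt_trans.
exact: metric_triangle.
Qed.

(** A half-radius ball is too small to hold two points of a net: this is where
    strict nets pair with closed balls and non-strict nets with open ones. *)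
Lemma net_half_ball k r S c x y : is_net k r S -> S x -> S y ->
  mball k c (r / 2) x -> mball k c (r / 2) y -> x = y.
Proof.
move=> netS Sx Sy cx cy; apply: contrapT => xy.
have := netS _ _ Sx Sy xy; have := metric_triangle x c y; rewrite (metric_sym x c).
case: k cx cy {netS} => /=; rewrite ?ballEmdist /= => cx cy; lra.
Qed.

Lemma net_card_le_doubling k (D : nat) S :
  doubling_bound X k D -> net_in_ball k S -> (S #<= `I_D)%card.
Proof.
move=> [D0 cover] [x [r [r0 netS Sxr]]].
have [C CD xrC] := cover x r r0.
have /choice[f fP] : forall y, exists c, S y -> c \in C /\ mball k c (r / 2) y.
  move=> y; have [Sy|nSy] := pselect (S y); last by exists point.
  by have [c cC cy] := xrC _ (Sxr _ Sy); exists c.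
have f_inj : {in S &, injective f}.
  move=> y z; rewrite !inE => Sy Sz fyz.
  apply: (net_half_ball netS Sy Sz (proj2 (fP _ Sy))).
  by rewrite fyz; exact: (proj2 (fP _ Sz)).
rewrite -(card_le_eql (inj_card_eq f_inj)).
apply: (@card_le_trans _ _ _ [set` C]).
  by apply: subset_card_le => _ [y Sy <-]; exact: (proj1 (fP _ Sy)).
apply: (@card_le_trans _ _ _ `I_(size C)); last by rewrite card_le_II.
apply/pcard_geP/surjPex; exists (nth point C) => y /= yC.
by exists (index y C); [rewrite /= index_mem | rewrite nth_index].
Qed.

Lemma exists_max_net_card k (D : nat) : doubling_bound X k D ->
  exists2 M, is_max_net_card X k M & (M <= D)%N.
Proof.
move=> DX.
pose P n := `[< exists2 S : set X, net_in_ball k S & (S #= `I_n)%card >].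
have P0 : exists n, P n.
  exists 0%N; apply/asboolP; exists set0; last by rewrite II0 card_eq0.
  by exists point, 1; split => // x y [].
have PD n : P n -> (n <= D)%N.
  move=> /asboolP[S /(net_card_le_doubling DX) SD Sn].
  by rewrite -card_le_II -(card_le_eql Sn).
case: (ex_maxnP P0 PD) => M /asboolP PM Mmax; exists M; last first.
  by apply: PD; apply/asboolP.
split=> // S netS.
have /finite_setP[n Sn] : finite_set S.
  by apply/finite_set_leP; exists D; exact: (net_card_le_doubling DX netS).
rewrite (card_le_eql Sn) card_le_II; apply: Mmax.
by apply/asboolP; exists S.
Qed.

Lemma max_net_size k (M : nat) x r (l : seq X) : is_max_net_card X k M ->
  0 < r -> uniq l -> is_net k r [set` l] -> [set` l] `<=` mball k x r ->
  (size l <= M)%N.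
Proof.
move=> [_ maxM] r0 ul netl lx; rewrite -card_le_II.
have lM : ([set` l] #<= `I_M)%card by apply: maxM; exists x, r.
apply: card_le_trans lM.
apply/pcard_geP/surjPex; exists (index^~ l) => i /= il.
exists (nth point l i); first exact: mem_nth.
exact: index_uniq.
Qed.

(** Iterating the doubling property makes balls totally bounded. *)
Lemma finite_cover k x r e : geometrically_doubling X k -> 0 < r -> 0 < e ->
  exists C : seq X, forall y, mdist x y < r -> exists2 c, c \in C & mdist c y < e.
Proof.
move=> [D [_ cover]] r0 e0.
have iter_cover n : exists C : seq X,
    mball k x r `<=` \bigcup_(c in [set` C]) mball k c (r / 2 ^+ n).
  elim: n => [|n [C xrC]].
    by exists [:: x] => y xy; exists x; rewrite /= ?inE ?expr0 ?divr1.
  have rn0 : 0 < r / 2 ^+ n by rewrite divr_gt0 // exprn_gt0.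
  have /choice[f fP] : forall c, exists C' : seq X,
      mball k c (r / 2 ^+ n) `<=` \bigcup_(c' in [set` C']) mball k c' (r / 2 ^+ n.+1).
    move=> c; have [C' _] := cover c _ rn0.
    by rewrite -mulrA -invfM -exprSr => ?; exists C'.
  exists (flatten (map f C)) => y /xrC [c cC cy].
  have [c' c'C c'y] := fP _ _ cy; exists c' => //=.
  by apply/flatten_mapP; exists c.
have [n rne] : exists n, r / 2 ^+ n < e.
  exists (Num.truncn (r / e)); rewrite ltr_pdivrMr ?exprn_gt0 // mulrC.
  rewrite -ltr_pdivrMr //; apply: lt_le_trans (truncnS_gt _) _.
  by rewrite -natrX ler_nat ltn_expl.
have [C xrC] := iter_cover n; exists C => y xy.
have [|c cC cy] := xrC y; first by apply: ball_mball; rewrite ballEmdist.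
by exists c => //; have := mball_ball rne cy; rewrite ballEmdist.
Qed.

(** The dense set is listed as a sequence of finite sets, so that measurability
    of unions over it is immediate. *)
Lemma doubling_separable k : geometrically_doubling X k ->
  exists C : nat -> seq X, forall x e, 0 < e ->
    exists n, exists2 c, c \in C n & mdist c x < e.
Proof.
move=> dX.
have /choice[C CP] : forall n, exists C : seq X, forall y,
    mdist point y < n.+1%:R -> exists2 c, c \in C & mdist c y < n.+1%:R^-1.
  by move=> n; apply: (finite_cover point dX); rewrite ?invr_gt0 ltr0n.
exists C => x e e0; pose n := Num.truncn (mdist point x + e^-1).
have nP : mdist point x + e^-1 < n.+1%:R by exact: truncnS_gt.
have x0 : 0 <= mdist (point : X) x by exact: mdist_ge0.
have ei0 : 0 < e^-1 by rewrite invr_gt0.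
have [|c cC cx] := CP n x; first by lra.
exists n, c => //; apply: lt_trans cx _.
by rewrite invf_plt ?posrE ?ltr0n //; lra.
Qed.

(** Greedy choice: pick a point of [E] where [m] is smallest up to the factor
    [a], delete the ball around it, and repeat. The bound [b] keeps the infimum
    positive, so that such a point exists; the chosen points form a net, so the
    process stops. *)
Lemma greedy_net k r (E : set X) (m : X -> R) (n : nat) (a b : R) :
  0 < r -> 1 < a -> 0 < b -> (forall x, E x -> b <= m x) ->
  (forall l : seq X, uniq l -> is_net k r [set` l] -> [set` l] `<=` E ->
    (size l <= n)%N) ->
  exists l : seq X, [/\ (size l <= n)%N, [set` l] `<=` E &
    forall x, E x -> exists2 c, c \in l & mball k c r x /\ m c <= a * m x].
Proof.
move=> r0 a1 b0; elim: n E => [|n IH] E bm netE.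
  exists [::]; split => // x Ex.
  suff : (size [:: x] <= 0)%N by [].
  apply: netE => // [y z /=|y /=]; rewrite !inE => /eqP -> //.
  by move=> /eqP ->.
have [->|/set0P[x0 Ex0]] := eqVneq E set0; first by exists [::]; split.
have infE : has_inf (m @` E).
  by split; [exists (m x0), x0 | exists b => _ [x Ex <-]; exact: bm].
have b_inf : b <= inf (m @` E).
  by apply: lb_le_inf => [|_ [x Ex <-]]; [exists (m x0), x0 | exact: bm].
have eps0 : 0 < (a - 1) * inf (m @` E).
  by rewrite mulr_gt0 ?subr_gt0 // (lt_le_trans b0).
have [_ [c Ec <-] mc] := inf_adherent eps0 infE.
have mcP x : E x -> m c <= a * m x.
  move=> Ex; apply: (le_trans (ltW mc)).
  rewrite -{1}[inf _]mul1r -mulrDl addrC subrK ler_pM2l ?(lt_trans _ a1) //.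
  by apply: ge_inf; [case: infE | exists x].
have cE' x : mball k c r x = (match k with OpenBalls => mdist c x < r
  | ClosedBalls => mdist c x <= r end) by case: (k); rewrite //= ballEmdist.
have [|l ul netl lE|l [ln lE lcov]] := IH (E `\` mball k c r).
- by move=> x [Ex _]; exact: bm.
- have cl : c \notin l.
    by apply/negP => /lE [_]; apply; exact: mball_center.
  have far x : x \in l -> match k with OpenBalls => r <= mdist c x
      | ClosedBalls => r < mdist c x end.
    move=> /lE [_]; rewrite cE'.
    by case: (k) => /negP; rewrite -?leNgt -?ltNge.
  rewrite -ltnS -[_.+1]/(size (c :: l)); apply: netE => /=.
  + by rewrite cl ul.
  + move=> x y /=; rewrite !inE => /orP[/eqP ->|xl] /orP[/eqP ->|yl] // xy.
    * exact: far.
    * by rewrite metric_sym; exact: far.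
    * exact: netl.
  + by move=> x /=; rewrite inE => /orP[/eqP -> //|/lE[]].
exists (c :: l); split => //.
  by move=> x /=; rewrite inE => /orP[/eqP -> //|/lE[]].
move=> x Ex; have [cx|ncx] := pselect (mball k c r x).
  by exists c; [rewrite mem_head | split => //; exact: mcP].
have [c' c'l c'x] := lcov x (conj Ex ncx).
by exists c' => //; rewrite inE c'l orbT.
Qed.

End metric.

(** * Integral inequalities *)

Section sigma_finite_of.
Context d (T : measurableType d) (R : realType).
Variable mu : {measure set T -> \bar R}.

(** The same measure under a name that carries the proof of sigma-finiteness, so
    that Tonelli's theorem for bundled sigma-finite measures applies to it. *)
Definition sigma_finite_of & sigma_finite setT mu : set T -> \bar R := mu.

Variable sf : sigma_finite setT mu.

HB.instance Definition _ := Measure.copy (sigma_finite_of sf) mu.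
HB.instance Definition _ :=
  Measure_isSigmaFinite.Build _ _ _ (sigma_finite_of sf) sf.

End sigma_finite_of.

Lemma conjugate_exponent (R : realType) (p : R) : 1 < p ->
  p^-1 + (p / (p - 1))^-1 = 1.
Proof. by move=> p1; field; lra. Qed.

Lemma conjugate_exponentM (R : realType) (p : R) : 1 < p ->
  (p / (p - 1))^-1 * p = p - 1.
Proof. by move=> p1; field; lra. Qed.

Section abstract_measure.
Context d (T : measurableType d) (R : realType).
Variable mu : {measure set T -> \bar R}.
Local Open Scope ereal_scope.

Lemma measurable_integral_kernel (K : T * T -> \bar R) :
  sigma_finite setT mu -> measurable_fun setT K -> (forall z, 0 <= K z) ->
  measurable_fun setT (fun x => \int[mu]_y K (x, y)).
Proof.
move=> sf mK K0.
exact: (@measurable_fun_fubini_tonelli_F _ _ _ _ _ (sigma_finite_of sf) K).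
Qed.

(** The L^1 half of Schur's test: swap the integrals. *)
Lemma schur_test (K : T * T -> \bar R) (g : T -> \bar R) (M : \bar R) :
  sigma_finite setT mu -> measurable_fun setT K -> (forall z, 0 <= K z) ->
  measurable_fun setT g -> (forall y, 0 <= g y) -> 0 <= M ->
  (forall y, \int[mu]_x K (x, y) <= M) ->
  \int[mu]_x \int[mu]_y (K (x, y) * g y) <= M * \int[mu]_y g y.
Proof.
move=> sf mK K0 mg g0 M0 KM.
have mKg : measurable_fun setT (fun z : T * T => K z * g z.2).
  by apply: emeasurable_funM => //; exact: measurableT_comp.
have mK1 y : measurable_fun setT (fun x => K (x, y)).
  by apply: measurableT_comp.
have -> : \int[mu]_x \int[mu]_y (K (x, y) * g y) =
          \int[mu]_y \int[mu]_x (K (x, y) * g y).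
  by apply: (@fubini_tonelli _ _ _ _ _ (sigma_finite_of sf) (sigma_finite_of sf)
      (fun z => K z * g z.2)) => // z; rewrite mule_ge0.
rewrite -ge0_integralZl //; apply: ge0_le_integral => //.
- by move=> y _; apply: integral_ge0 => x _; rewrite mule_ge0.
- apply: (@measurable_fun_fubini_tonelli_G _ _ _ _ _ (sigma_finite_of sf)
    (fun z => K z * g z.2)) => // z.
  by rewrite mule_ge0.
- exact: emeasurable_funM.
- by move=> y _; rewrite ge0_integralZr // lee_wpmul2r.
Qed.

(** Jensen's inequality for the power function, from Hoelder's inequality
    against an indicator. *)
Lemma powR_integral_le (D : set T) (f : T -> R) (p : R) :
  measurable D -> 0 < mu D < +oo -> measurable_fun setT f -> (1 <= p)%R ->
  (\int[mu]_(x in D) `|f x|%:E) `^ p <=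
    (fine (mu D) `^ (p - 1))%:E * \int[mu]_(x in D) (`|f x| `^ p)%:E.
Proof.
move=> mD /andP[muD0 muDoo] mf.
rewrite le_eqVlt => /predU1P[<-|p1].
  rewrite subrr powRr0 mul1e poweRe1; last exact: integral_ge0.
  by under [leRHS]eq_integral do rewrite powRr1 //.
have p0 : (0 < p)%R by exact: lt_trans p1.
have q0 : (0 < p / (p - 1))%R by rewrite divr_gt0 // subr_gt0.
have muDfin : mu D \is a fin_num by rewrite ge0_fin_numE // ltW.
have := @hoelder _ _ _ mu (f \* \1_D)%R (\1_D : T -> R) p (p / (p - 1))%R
  (measurable_funM mf (measurable_indic mD)) (measurable_indic mD) p0 q0.
move=> /(_ (conjugate_exponent p1)).
have patchE (g : T -> R) : \int[mu]_(x in D) (g x)%:E = \int[mu]_x (g x * \1_D x)%:E.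
  by rewrite integral_mkcond; apply: eq_integral => x _; rewrite epatch_indic.
have -> : 'N[mu]_1[EFin \o ((f \* \1_D) \* \1_D)%R] = \int[mu]_(x in D) `|f x|%:E.
  rewrite Lnorm1 patchE; apply: eq_integral => x _ /=.
  rewrite !normrM /indic; case: (x \in D); rewrite ?normr1 ?normr0 ?mulr1 ?mulr0 //.
move=> hold.
have {}hold := @gt0_ler_poweR _ p (ltW p0) _ _ _ _ hold.
apply: le_trans (hold _ _) _.
- by rewrite in_itv /= leey andbT; exact: integral_ge0.
- by rewrite in_itv /= leey andbT mule_ge0 //; exact: Lnorm_ge0.
rewrite poweRM ?Lnorm_ge0 // poweR_Lnorm ?gt_eqF // muleC le_eqVlt; apply/orP; left; apply/eqP.
congr (_ * _).
  rewrite unlock -poweRrM.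
  have -> : \int[mu]_x `|(EFin \o \1_D) x| `^ (p / (p - 1)) = mu D.
    rewrite -[RHS]mul1e -integral_cst // patchE; apply: eq_integral => x _ /=.
    rewrite /indic; case: (x \in D);
      by rewrite ?normr1 ?normr0 ?mulr1 ?mulr0 ?powR1 ?powR0 ?gt_eqF.
  rewrite conjugate_exponentM //.
  by rewrite -[in LHS](fineK muDfin).
rewrite patchE; apply: eq_integral => x _ /=.
rewrite /indic; case: (x \in D); rewrite ?mulr1 ?mulr0 ?normr0 ?powR0 ?gt_eqF//.
Qed.

End abstract_measure.

(** * Measurability and mass of balls *)

Section metric_measure.
Context {R : realType} {X : pmetricType R}.
Variable mu : {measure set (borel X) -> \bar R}.
Variable k : ball_kind.
Hypothesis dX : geometrically_doubling X k.
Hypothesis hmu : is_metric_measure mu.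
Local Open Scope ereal_scope.

Let supp : set (borel X) := msupport mu.

Lemma open_measurable_borel (U : set X) :
  open U -> measurable (U : set (borel X)).
Proof. by move=> oU; apply: sub_sigma_algebra. Qed.

(** Separability makes the open set of pairs at distance less than [r] a
    countable union of products of balls, hence measurable for the product of
    the Borel sigma-algebras. *)
Lemma measurable_mdist_lt (r : R) :
  measurable [set z : borel X * borel X | (mdist (z.1 : X) z.2 < r)%R].
Proof.
have [C CP] := doubling_separable dX.
rewrite (_ : mkset _ = \bigcup_n \bigcup_m \bigcup_(c in [set` C m])
  ((ball c n.+1%:R^-1 : set (borel X)) `*`
   (ball c (r - n.+1%:R^-1)%R : set (borel X)))); last first.
  apply/seteqP; split => [[x y] /= xy|[x y] /=]; last first.
    move=> [n _ [m _ [c _ [] /=]]]; rewrite !ballEmdist /= => cx cy.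
    have := metric_triangle (x : X) c y; rewrite (metric_sym (x : X) c) => xy.
    by apply: (le_lt_trans xy); rewrite -(subrKC (n.+1%:R^-1)%R r) ltrD.
  have e0 : (0 < (r - mdist (x : X) y) / 2)%R by rewrite divr_gt0 // subr_gt0.
  (* With [t] the first radius, [d(c, y) < t + d(x, y)] must be at most [r - t]: hence
     the factor 2. *)
  pose n := Num.truncn ((r - mdist (x : X) y) / 2)^-1.
  have nP : (n.+1%:R^-1 < (r - mdist (x : X) y) / 2)%R.
    by rewrite invf_plt ?posrE ?ltr0n //; exact: truncnS_gt.
  have n0 : (0 < n.+1%:R^-1 :> R)%R by rewrite invr_gt0 ltr0n.
  have [m [c cC cx]] := CP x _ n0.
  exists n => //; exists m => //; exists c => //; split; rewrite !ballEmdist //=.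
  apply: (le_lt_trans (metric_triangle c x y)).
  by move: nP cx; set t := (_^-1)%R; set u := mdist x y; set v := mdist c x; lra.
apply: bigcupT_measurable => n; apply: bigcupT_measurable => m.
apply: fin_bigcup_measurable; first exact: finite_seq.
by move=> c _; apply: measurableX; apply: open_measurable_borel;
  exact: open_mdist_ball.
Qed.

Lemma measurable_mball_pairs (r : R) :
  measurable [set z : borel X * borel X | mball k z.1 r (z.2 : X)].
Proof.
case: (k) => /=.
  rewrite (_ : mkset _ = [set z : borel X * borel X | (mdist (z.1 : X) z.2 < r)%R]).
    exact: measurable_mdist_lt.
  by apply/seteqP; split => z /=; rewrite ballEmdist.
rewrite (_ : mkset _ = \bigcap_n
    [set z : borel X * borel X | (mdist (z.1 : X) z.2 < r + n.+1%:R^-1)%R]).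
  by apply: bigcapT_measurable => n; exact: measurable_mdist_lt.
apply/seteqP; split => z /=.
  by move=> zr n _ /=; apply: (le_lt_trans zr); rewrite ltrDl invr_gt0 ltr0n.
move=> zr; apply/ler_addgt0Pr => e e0.
apply: (le_trans (ltW (zr (Num.truncn e^-1) I))); rewrite lerD2l ltW //.
by rewrite invf_plt ?posrE ?ltr0n //; exact: truncnS_gt.
Qed.

Lemma measurable_mball (x : X) (r : R) : measurable (mball k x r : set (borel X)).
Proof.
rewrite (_ : mball k x r = xsection
  [set z : borel X * borel X | mball k z.1 r (z.2 : X)] (x : borel X)).
  by apply: measurable_xsection; exact: measurable_mball_pairs.
by apply/seteqP; split => y; rewrite /xsection /= ?inE.
Qed.

Lemma measure_mball_lty (x : X) (r : R) : mu (mball k x r) < +oo.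
Proof.
have [_ bnd _] := hmu; apply: bnd; first exact: measurable_mball.
by exists x, (r + 1)%R; apply: mball_ball; rewrite ltrDl.
Qed.

Lemma sigma_finite_metric_measure : sigma_finite setT mu.
Proof.
exists (fun n => ball (point : X) n.+1%:R).
  apply/seteqP; split => // x _; exists (Num.truncn (mdist (point : X) x)) => //.
  by rewrite ballEmdist /=; exact: truncnS_gt.
move=> n; have mb := open_measurable_borel (open_mdist_ball (point : X) n.+1%:R).
by split => //; have [_ bnd _] := hmu; apply: bnd => //; exists point, n.+1%:R.
Qed.

Lemma msupport_closed : closed (msupport mu).
Proof.
rewrite /msupport closedC (_ : mkset _ =
  \bigcup_(U in [set U | exists (x : X) r, mu (ball x r) = 0 /\ U = ball x r]) U).
  by apply: bigcup_open => _ [x [r [_ ->]]]; exact: open_mdist_ball.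
apply/seteqP; split => y /=.
  by move=> [x [r [xr0 xry]]]; exists (ball x r) => //; exists x, r.
by move=> [_ [x [r [xr0 ->]]] xry]; exists x, r.
Qed.

Lemma measurable_msupport : measurable supp.
Proof.
rewrite -[supp]setCK; apply: measurableC; apply: open_measurable_borel.
by rewrite openC; exact: msupport_closed.
Qed.

(** Finite unions of null balls are null, and tau-additivity passes this to the
    union of all of them. *)
Lemma measure_setC_msupport : mu (~` supp) = 0.
Proof.
have [tau _ _] := hmu.
pose F := [set U : set X | exists (x : X) r, mu (ball x r) = 0 /\ U = ball x r].
have -> : ~` supp = \bigcup_(U in F) U.
  rewrite /supp /msupport setCK; apply/seteqP; split => y /=.
    by move=> [x [r [xr0 xry]]]; exists (ball x r) => //; exists x, r.
  by move=> [_ [x [r [xr0 ->]]] xry]; exists x, r.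
rewrite tau; last by move=> _ [x [r [_ ->]]]; exact: open_mdist_ball.
apply/eqP; rewrite eq_le; apply/andP; split; last first.
  apply: ereal_sup_ubound; exists set0; last by rewrite bigcup_set0 measure0.
  by split; [exact: finite_set0 | exact: sub0set].
apply: ge_ereal_sup => _ [G [/finite_seqP[s ->] GF] <-].
rewrite bigcup_seq; elim: s GF => [|U s IH] GF; first by rewrite big_nil measure0.
have mU V : V \in U :: s -> measurable (V : set (borel X)).
  move=> /GF [x [r [_ ->]]]; by apply: open_measurable_borel; exact: open_mdist_ball.
rewrite big_cons; apply: le_trans (measureU2 _ _ _) _.
- by apply: mU; rewrite mem_head.
- rewrite big_seq_cond; apply: bigsetU_measurable => V /andP[Vs _].
  by apply: mU; rewrite inE Vs orbT.
have mU0 : mu U <= 0 by have [x [r [<- ->]]] := GF U (mem_head _ _).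
rewrite -[leRHS]adde0; apply: leeD; first exact: mU0.
by apply: IH => V /= Vs; apply: GF; rewrite /= inE Vs orbT.
Qed.

Lemma measure_mball_gt0 (x : X) (r : R) : (0 < r)%R -> supp x -> 0 < mu (mball k x r).
Proof.
move=> r0 sx; apply: (@lt_le_trans _ _ (mu (ball x r))); last first.
  rewrite le_measure ?inE //; last exact: ball_mball.
    by apply: open_measurable_borel; exact: open_mdist_ball.
  exact: measurable_mball.
rewrite lt0e measure_ge0 andbT; apply/eqP => xr0; apply: sx.
by exists x, r; split => //; rewrite ballEmdist /= mdistxx.
Qed.

End metric_measure.

(** * The averaging kernel *)

Section averaging_kernel.
Context {R : realType} {X : pmetricType R}.
Variable mu : {measure set (borel X) -> \bar R}.
Variable k : ball_kind.
Hypothesis dX : geometrically_doubling X k.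
Hypothesis hmu : is_metric_measure mu.
Variable r : R.
Hypothesis r0 : 0 < r.
Local Open Scope ereal_scope.

Let T := borel X.
Let supp : set T := msupport mu.
Let ball_mass (x : X) : R := fine (mu (mball k x r)).
Let pairs : set (T * T) := [set z | mball k z.1 r (z.2 : X)].

Lemma ball_mass_gt0 (x : X) : msupport mu x -> (0 < ball_mass x)%R.
Proof.
by move=> sx; rewrite fine_gt0 // (measure_mball_lty dX hmu) (measure_mball_gt0 dX).
Qed.

Lemma ball_massE (x : X) : mu (mball k x r) = (ball_mass x)%:E.
Proof.
by rewrite fineK // ge0_fin_numE ?measure_ge0 // (measure_mball_lty dX hmu).
Qed.

Lemma measurable_ball_mass : measurable_fun setT (ball_mass : T -> R).
Proof.
have mK : measurable_fun setT (fun z : T * T => (\1_pairs z)%:E : \bar R).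
  by apply/measurable_EFinP; apply: measurable_indic; exact: measurable_mball_pairs.
have := measurable_integral_kernel (sigma_finite_metric_measure hmu) mK.
move=> /(_ _)/(measurableT_comp (@fine_measurable R setT measurableT)) mm.
apply: eq_measurable_fun (mm _) => [x _ /=|z]; last by rewrite lee_fin.
rewrite /ball_mass -[in RHS](setIT (mball k x r)) -integral_indic //.
exact: (measurable_mball dX).
Qed.

(** The averaging operator is integration against this kernel. *)
Definition avg_kernel (z : T * T) : \bar R :=
  (\1_supp z.1 * (ball_mass z.1)^-1 * \1_pairs z)%:E.

Lemma avg_kernel_ge0 z : 0 <= avg_kernel z.
Proof. by rewrite lee_fin !mulr_ge0 // invr_ge0 fine_ge0. Qed.

Lemma measurable_avg_kernel : measurable_fun setT avg_kernel.
Proof.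
apply/measurable_EFinP; apply: measurable_funM; last first.
  by apply: measurable_indic; exact: measurable_mball_pairs.
apply: measurable_funM.
  apply: measurableT_comp => //; apply: measurable_indic.
  exact: measurable_msupport.
have -> : (fun z : T * T => (ball_mass z.1)^-1)%R =
    (fun z : T * T => ball_mass z.1 `^ (-1))%R.
  by apply/funext => z; rewrite powR_inv1 // fine_ge0.
apply: (measurableT_comp (measurable_powR _)).
exact: (measurableT_comp measurable_ball_mass).
Qed.

Lemma integral_avg_kernel (x : T) (h : T -> \bar R) : supp x ->
  measurable_fun setT h -> (forall y, 0 <= h y) ->
  \int[mu]_y (avg_kernel (x, y) * h y) =
  ((ball_mass x)^-1)%:E * \int[mu]_(y in mball k x r) h y.
Proof.
move=> sx mh h0; have mB := measurable_mball dX x r.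
rewrite [X in _ * X]integral_mkcond -ge0_integralZl //.
- apply: eq_integral => y _; rewrite epatch_indic /avg_kernel /= !indicE.
  rewrite mem_set // mul1r EFinM -muleA; congr (_ * _); rewrite muleC; congr (_ * _).
- by apply/(measurable_restrictT _ mB)/measurable_funTS.
- by move=> y _; rewrite /patch; case: ifP.
- by rewrite lee_fin invr_ge0 fine_ge0.
Qed.

(** Total boundedness gives finitely many balls of radius [r / 2] such that every
    [x] near [y] lies in one of them, which the ball of radius [r] around [x] then
    contains. They are taken open for both kinds of balls, because an open ball
    that meets the support has positive mass, while a closed one need not. *)
Lemma ball_mass_lower_bound (y : X) : exists2 b, (0 < b)%R &
  forall x, msupport mu x -> mball k y r x -> (b <= ball_mass x)%R.
Proof.
have r2 : (0 < r / 2)%R by rewrite divr_gt0.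
have [C CP] := finite_cover y dX (addr_gt0 r0 r0) r2.
pose v c : R := fine (mu (ball c (r / 2))).
have [b b0 bP] : exists2 b : R, (0 < b)%R &
    forall c, c \in C -> (0 < v c)%R -> (b <= v c)%R.
  elim: (C) => [|c s [b b0 bP]]; first by exists 1%R.
  have [vc|vc] := ltP 0%R (v c).
    exists (Num.min b (v c)); first by rewrite lt_min b0.
    move=> c'; rewrite inE ge_min => /orP[/eqP ->|c's] vc'; first by rewrite lexx orbT.
    by rewrite bP.
  exists b => // c'; rewrite inE => /orP[/eqP ->|]; last exact: bP.
  by rewrite ltNge vc.
exists b => // x sx xy.
have [|c cC cx] := CP x.
  have := @mball_ball _ _ k y r (r + r) _ _ xy; rewrite ballEmdist; apply.
  by rewrite ltrDl.
have mc := open_measurable_borel (open_mdist_ball c (r / 2)%R).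
have sub_x : ball c (r / 2)%R `<=` mball k x r.
  apply: subset_trans (@ball_mball _ _ k x r) => z; rewrite !ballEmdist /= => cz.
  apply: (le_lt_trans (metric_triangle x c z)).
  by rewrite (metric_sym x c) (splitr r) ltrD.
have le_m : mu (ball c (r / 2)%R) <= mu (mball k x r).
  by rewrite le_measure ?inE //; exact: (measurable_mball dX).
have fin_c : mu (ball c (r / 2)%R) \is a fin_num.
  rewrite ge0_fin_numE ?measure_ge0 //.
  exact: (le_lt_trans le_m (measure_mball_lty dX hmu _ _)).
apply: (@le_trans _ _ (v c)); last by rewrite -lee_fin -ball_massE fineK.
apply: bP => //; rewrite -lte_fin fineK // lt0e measure_ge0 andbT.
by apply/eqP => c0; apply: sx; exists c, (r / 2)%R; split => //; rewrite ballEmdist.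
Qed.

(** Greedily chosen centres [c] cover the support near [y] by at most [M] balls,
    each of mass at most [a * ball_mass x] for the points [x] it serves; so each
    ball contributes at most [a] to the integral. The bound [M] applies because
    the centres form a net inside the single ball around [y]. *)
Lemma integral_avg_kernel_le (M : nat) (y : T) : is_max_net_card X k M ->
  \int[mu]_x avg_kernel (x, y) <= M%:R%:E.
Proof.
move=> hM; apply/lee_addgt0Pr => e e0.
(* This ratio makes [a * M <= M + e], also when [M = 0]. *)
pose a := (1 + e / M.+1%:R)%R.
have a1 : (1 < a)%R by rewrite ltrDl divr_gt0 // ltr0n.
have a0 : (0 < a)%R by exact: lt_trans a1.
pose E : set X := msupport mu `&` mball k y r.
have [b b0 bP] := ball_mass_lower_bound y.
have [|l ul netl lE|l [lM lE lP]] := @greedy_net _ X k r E ball_mass M a b r0 a1 b0.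
- by move=> x [sx xy]; exact: bP.
- by apply: (@max_net_size _ _ k M y r l hM r0 ul netl) => x /lE[].
have mB c : measurable (mball k c r : set T) by exact: (measurable_mball dX).
pose F (c : X) (x : T) : \bar R := (a / ball_mass c)%:E * (\1_(mball k c r) x)%:E.
have mF c : measurable_fun setT (F c).
  apply: emeasurable_funM => //; apply/measurable_EFinP.
  exact: measurable_indic.
have F0 c x : 0 <= F c x.
  rewrite mule_ge0 // lee_fin // divr_ge0 ?(ltW a0) //; exact: fine_ge0.
apply: (@le_trans _ _ (\int[mu]_x \sum_(c <- l) F c x)).
  apply: ge0_le_integral => //.
  - by move=> x _; exact: avg_kernel_ge0.
  - by apply: (measurableT_comp measurable_avg_kernel).
  - exact: emeasurable_sum.
  move=> x _; have [Ex|nEx] := pselect (E x); last first.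
    rewrite (_ : avg_kernel _ = 0) ?sume_ge0 //.
    rewrite /avg_kernel !indicE; apply/congr1.
    case: (boolP (x \in supp)) => [/set_mem sx|_]; last by rewrite !mul0r.
    have nxy : ~ pairs (x, y).
      by move=> xy; apply: nEx; split=> //; rewrite mball_sym.
    by rewrite (memNset nxy) mulr0.
  (* A single term of the sum, that of a ball serving [x], already dominates. *)
  have [c cl [cx mc]] := lP x Ex.
  have [sc _] := lE c cl.
  rewrite (big_rem c cl) /=; apply: (@le_trans _ _ (F c x)); last first.
    by rewrite leeDl // sume_ge0.
  rewrite /F -EFinM lee_fin !indicE (mem_set cx) mulr1.
  have [sx xy] := Ex.
  have pxy : pairs (x, y) by rewrite /pairs /= mball_sym.
  rewrite (mem_set sx) (mem_set pxy) mul1r mulr1 /=.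
  by rewrite ler_pdivlMr ?ball_mass_gt0 // mulrC ler_pdivrMr ?ball_mass_gt0.
rewrite ge0_integral_sum //.
rewrite [leLHS](_ : _ = \sum_(c <- l) a%:E); last first.
  apply: eq_big_seq => c cl; have [sc _] := lE c cl.
  rewrite ge0_integralZl //; last 2 first.
  - by apply/measurable_EFinP; exact: measurable_indic.
  - by rewrite lee_fin divr_ge0 ?(ltW a0) //; exact: fine_ge0.
  rewrite integral_indic // setIT ball_massE -EFinM divfK // gt_eqF //.
  exact: ball_mass_gt0.
rewrite sumEFin -EFinD lee_fin big_const_seq count_predT iter_addr_0 -[leLHS]mulr_natr.
apply: (@le_trans _ _ (a * M%:R)%R).
  by apply: ler_wpM2l; rewrite ?ler_nat // ltW.
rewrite /a mulrDl mul1r lerD2l -mulrA ler_piMr ?(ltW e0) //.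
by rewrite mulrC ler_pdivrMr ?ltr0n // mul1r ler_nat.
Qed.

End averaging_kernel.

(** * The averaging operator *)

Lemma abs_fine_le (R : realType) (a : \bar R) : (`|fine a|%:E <= `|a|)%E.
Proof. by case: a => [a| |] /=; rewrite ?lexx ?leey. Qed.

(** With infinite [a] and [b] both differences degenerate in the same way; this
    keeps [measurable_averaging] free of integrability conditions. *)
Lemma fine_scaleB (R : realType) (c : R) (a b : \bar R) : 0 < c ->
  fine (c%:E * a - c%:E * b)%E = c * fine (a - b)%E.
Proof.
move=> c0; case: a b => [a| |] [b| |] //=;
  rewrite ?(gt0_muley, gt0_muleNy) ?lte_fin //= ?mulr0 //.
by rewrite mulrBr.
Qed.

Section averaging_bounds.
Context {R : realType} {X : pmetricType R}.
Variable mu : {measure set (borel X) -> \bar R}.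
Variable k : ball_kind.
Hypothesis dX : geometrically_doubling X k.
Hypothesis hmu : is_metric_measure mu.
Variable r : R.
Hypothesis r0 : 0 < r.
Local Open Scope ereal_scope.

Let T := borel X.
Let supp : set T := msupport mu.
Let ball_mass (x : X) : R := fine (mu (mball k x r)).

Lemma averaging_supp (f : T -> R) (x : T) : supp x ->
  averaging mu k r f x =
  ((ball_mass x)^-1 * fine (\int[mu]_(y in mball k x r) (f y)%:E))%R.
Proof. by move=> sx; rewrite /averaging mem_set. Qed.

Lemma averaging_nsupp (f : T -> R) (x : T) : ~ supp x ->
  averaging mu k r f x = 0%R.
Proof. by move=> sx; rewrite /averaging memNset. Qed.

Lemma measurable_averaging (f : T -> R) : measurable_fun setT f ->
  measurable_fun setT (averaging mu k r f : T -> R).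
Proof.
move=> mf.
have mE : measurable_fun setT (EFin \o f) by exact/measurable_EFinP.
have mI (h : T -> \bar R) : measurable_fun setT h -> (forall y, 0 <= h y) ->
    measurable_fun setT (fun x : T => \int[mu]_y (avg_kernel mu k r (x, y) * h y)).
  move=> mh h0.
  apply: (measurable_integral_kernel (sigma_finite_metric_measure hmu)
    (K := fun z => avg_kernel mu k r z * h z.2)).
    apply: emeasurable_funM; first exact: measurable_avg_kernel.
    exact: measurableT_comp.
  by move=> z; rewrite mule_ge0 // avg_kernel_ge0.
have mp := mI _ (measurable_funepos mE) (fun y => funepos_ge0 _ y).
have mn := mI _ (measurable_funeneg mE) (fun y => funeneg_ge0 _ y).
have mF := measurableT_comp (@fine_measurable R setT measurableT)
  (emeasurable_funB mp mn).
apply: eq_measurable_fun mF => x _ /=; have [sx|nsx] := pselect (supp x); last first.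
  rewrite averaging_nsupp // !integral0_eq ?sube0 // => y _.
    by rewrite /avg_kernel /= indicE memNset // mul0r mul0r mul0e.
  by rewrite /avg_kernel /= indicE memNset // mul0r mul0r mul0e.
have m0 : (0 < ball_mass x)%R by exact: (ball_mass_gt0 dX hmu r0).
rewrite averaging_supp // [in RHS]integralE !(integral_avg_kernel dX) //=.
- by apply: fine_scaleB; rewrite invr_gt0.
- exact: measurable_funeneg.
- exact: measurable_funepos.
Qed.

(** Jensen's inequality on each ball; for [p = 1] this is the triangle
    inequality. *)
Lemma averaging_powR_le (p : R) (f : T -> R) (x : T) : (1 <= p)%R ->
  measurable_fun setT f ->
  (`|averaging mu k r f x| `^ p)%:E <=
  \int[mu]_y (avg_kernel mu k r (x, y) * (`|f y| `^ p)%:E).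
Proof.
move=> p1 mf; have p0 : (0 < p)%R by exact: lt_le_trans p1.
have [sx|nsx] := pselect (supp x); last first.
  rewrite averaging_nsupp // normr0 powR0 ?gt_eqF //.
  by apply: integral_ge0 => y _; rewrite mule_ge0 ?avg_kernel_ge0 // lee_fin powR_ge0.
have m0 : (0 < ball_mass x)%R by exact: (ball_mass_gt0 dX hmu r0).
have mE : measurable_fun setT (EFin \o f) by exact/measurable_EFinP.
have mB := measurable_mball dX x r.
have mfp : measurable_fun setT (fun y => (`|f y| `^ p)%:E).
  apply/measurable_EFinP; apply: (measurableT_comp (measurable_powR p)).
  exact: measurableT_comp.
rewrite (integral_avg_kernel dX) //.
have massE : mu (mball k x r) = (ball_mass x)%:E by exact: (ball_massE dX hmu).
have muB : 0 < mu (mball k x r) < +oo by rewrite massE lte_fin m0 ltry.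
set I := \int[mu]_(y in _) _.
have jensen := powR_integral_le mB muB mf p1; rewrite -/I massE /= in jensen.
set J := \int[mu]_(y in mball k x r) (f y)%:E.
have JI : `|fine J|%:E `^ p <= (ball_mass x `^ (p - 1))%:E * I.
  apply: le_trans jensen; apply: gt0_ler_poweR; rewrite ?(ltW p0) //.
  - by rewrite in_itv /= leey andbT lee_fin.
  - by rewrite in_itv /= leey andbT; apply: integral_ge0.
  apply: (@le_trans _ _ `|J|); first exact: abs_fine_le.
  exact: (le_abse_integral mu mB (measurable_funTS mE)).
rewrite averaging_supp // normrM powRM // EFinM ger0_norm ?invr_ge0 ?(ltW m0) //.
apply: (@le_trans _ _ (((ball_mass x)^-1 `^ p)%:E * ((ball_mass x `^ (p - 1))%:E * I))).
  by rewrite lee_wpmul2l // lee_fin powR_ge0.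
rewrite muleA -EFinM; apply: lee_wpmul2r.
  by apply: integral_ge0 => y _; rewrite lee_fin powR_ge0.
rewrite lee_fin -[(_^-1)%R]powR_inv1 ?(ltW m0) // -powRrM -powRD; last first.
  by apply/implyP => _; rewrite gt_eqF.
by rewrite mulN1r addKr.
Qed.

Lemma integral_averaging_powR_le (M : nat) (p : R) (f : T -> R) :
  is_max_net_card X k M -> (1 <= p)%R -> measurable_fun setT f ->
  \int[mu]_x (`|averaging mu k r f x| `^ p)%:E <=
  M%:R%:E * \int[mu]_x (`|f x| `^ p)%:E.
Proof.
move=> hM p1 mf.
have mfp (g : T -> R) : measurable_fun setT g ->
    measurable_fun setT (fun y => (`|g y| `^ p)%:E).
  move=> mg; apply/measurable_EFinP; apply: (measurableT_comp (measurable_powR p)).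
  exact: measurableT_comp.
have sf := sigma_finite_metric_measure hmu.
have mK := measurable_avg_kernel dX hmu r.
have gp0 (g : T -> R) y : 0 <= (`|g y| `^ p)%:E by rewrite lee_fin powR_ge0.
have := schur_test sf mK (avg_kernel_ge0 _ _ _) (mfp _ mf) (gp0 f)
  (ler0n _ M : 0 <= M%:R%:E) (fun y => integral_avg_kernel_le dX hmu r0 y hM).
apply: le_trans; apply: ge0_le_integral => //.
- by apply: mfp; exact: measurable_averaging.
- apply: (measurable_integral_kernel sf
    (K := fun z => avg_kernel mu k r z * (`|f z.2| `^ p)%:E)).
    by apply: emeasurable_funM => //; apply: measurableT_comp (mfp _ mf) _.
  by move=> z; rewrite mule_ge0 ?avg_kernel_ge0.
- by move=> x _; exact: averaging_powR_le.
Qed.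

Lemma Lnorm_averaging_le (M : nat) (p : R) (f : T -> R) :
  is_max_net_card X k M -> (1 <= p)%R -> measurable_fun setT f ->
  'N[mu]_p%:E[EFin \o averaging mu k r f] <=
  (M%:R `^ p^-1)%:E * 'N[mu]_p%:E[EFin \o f].
Proof.
move=> hM p1 mf; have p0 : (0 < p)%R by exact: lt_le_trans p1.
rewrite unlock /= -poweR_EFin -poweRM ?lee_fin ?ler0n //; last first.
  by apply: integral_ge0 => x _; rewrite lee_fin powR_ge0.
apply: gt0_ler_poweR; rewrite ?invr_ge0 ?(ltW p0) //.
- rewrite in_itv /= leey andbT.
  by apply: integral_ge0 => x _; rewrite lee_fin powR_ge0.
- rewrite in_itv /= leey andbT mule_ge0 ?lee_fin ?ler0n //.
  by apply: integral_ge0 => x _; rewrite lee_fin powR_ge0.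
exact: integral_averaging_powR_le.
Qed.

Lemma op_norm_averaging_le (M : nat) (p : R) :
  is_max_net_card X k M -> (1 <= p)%R ->
  op_norm mu p%:E (averaging mu k r) <= (M%:R `^ p^-1)%:E.
Proof.
move=> hM p1; apply: ereal_inf_lbound; exists (M%:R `^ p^-1)%R => //.
split=> [|f fp]; first exact: powR_ge0.
have mf : measurable_fun setT f by have := sub_Lfun_mfun fp; rewrite inE.
have le_N := Lnorm_averaging_le hM p1 mf; split=> //.
have f_fin : 'N[mu]_p%:E[EFin \o f] < +oo.
  by have := sub_Lfun_finLfun fp; rewrite inE.
apply/andP; split; first by rewrite inE; exact: measurable_averaging.
rewrite inE /= /finite_norm; apply: le_lt_trans le_N _.
by rewrite lte_mul_pinfty // lee_fin powR_ge0.
Qed.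

Lemma abs_averaging_le_ess_sup (f : T -> R) (x : T) :
  0 < mu setT -> measurable_fun setT f ->
  `|averaging mu k r f x|%:E <= ess_sup mu (abse \o (EFin \o f)).
Proof.
move=> mu0 mf; set N := ess_sup _ _.
have N0 : 0 <= N by apply: ess_sup_gee => //; apply: nearW => y /=.
have [sx|nsx] := pselect (supp x); last by rewrite averaging_nsupp // normr0.
have m0 : (0 < ball_mass x)%R by exact: (ball_mass_gt0 dX hmu r0).
have mE : measurable_fun setT (EFin \o f) by exact/measurable_EFinP.
have mB := measurable_mball dX x r.
have massE : mu (mball k x r) = (ball_mass x)%:E by exact: (ball_massE dX hmu).
rewrite averaging_supp // normrM EFinM ger0_norm ?invr_ge0 ?(ltW m0) //.
set J := \int[mu]_(y in _) _.
have JN : `|fine J|%:E <= N * (ball_mass x)%:E.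
  apply: (@le_trans _ _ `|J|); first exact: abs_fine_le.
  apply: le_trans (le_abse_integral mu mB (measurable_funTS mE)) _.
  rewrite -massE -integral_cst //; apply: ae_ge0_le_integral => //.
    by apply: measurableT_comp => //; exact: measurable_funTS.
  by apply: filterS (ess_sup_ge mu (abse \o (EFin \o f))) => y /= ? _.
apply: (@le_trans _ _ ((ball_mass x)^-1%:E * (N * (ball_mass x)%:E))).
  by rewrite lee_wpmul2l // lee_fin invr_ge0 ltW.
by rewrite muleCA -EFinM mulVf ?gt_eqF // mule1.
Qed.

Lemma metric_measure_setT_gt0 : 0 < mu setT.
Proof.
have [_ _ [A mA A0]] := hmu.
apply: (@lt_le_trans _ _ (mu A)); first by rewrite lt0e A0 measure_ge0.
by rewrite le_measure ?inE.
Qed.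

Lemma averaging_cst1 (x : T) : supp x -> averaging mu k r (cst 1%R) x = 1%R.
Proof.
move=> sx; have m0 : (0 < ball_mass x)%R by exact: (ball_mass_gt0 dX hmu r0).
rewrite averaging_supp // (integral_cst mu (measurable_mball dX x r) 1) mul1e.
by rewrite mulVf ?gt_eqF.
Qed.

Lemma op_norm_averaging_oo : op_norm mu +oo (averaging mu k r) = 1.
Proof.
have mu0 := metric_measure_setT_gt0.
have NooE (f : T -> R) :
    'N[mu]_+oo[EFin \o f] = ess_sup mu (abse \o (EFin \o f)).
  by rewrite unlock /= mu0.
have N1 (f : T -> R) : (\forall x \ae mu, f x = 1%R) -> 'N[mu]_+oo[EFin \o f] = 1.
  move=> f1; rewrite NooE; apply: ess_sup_ae_cst => //.
  by apply: filterS f1 => x /= ->; rewrite normr1.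
apply/eqP; rewrite eq_le; apply/andP; split.
  apply: ereal_inf_lbound; exists 1%R => //; split=> // f fp.
  have mf : measurable_fun setT f by have := sub_Lfun_mfun fp; rewrite inE.
  have le_N : 'N[mu]_+oo[EFin \o averaging mu k r f] <= 'N[mu]_+oo[EFin \o f].
    rewrite !NooE; apply/ess_supP/nearW => x /=.
    exact: abs_averaging_le_ess_sup.
  have f_fin : 'N[mu]_+oo[EFin \o f] < +oo.
    by have := sub_Lfun_finLfun fp; rewrite inE.
  split; last by rewrite mul1e.
  apply/andP; split; first by rewrite inE; exact: measurable_averaging.
  by rewrite inE /= /finite_norm; exact: le_lt_trans f_fin.
apply: le_ereal_inf_tmp => _ [C [C0 CP] <-].
have [|_] := CP (cst 1%R).
  apply/andP; split; first by rewrite inE; exact: measurable_cst.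
  by rewrite inE /= /finite_norm N1 ?ltry //; exact: nearW.
rewrite [X in _ <= _ * X]N1 ?mule1; last exact: nearW.
rewrite N1 //; exists (~` supp); split.
- by apply: measurableC; exact: measurable_msupport.
- exact: (measure_setC_msupport hmu).
- by move=> x /= + sx; apply; exact: averaging_cst1.
Qed.

End averaging_bounds.

Theorem theorem3p5 (R : realType) (X : pmetricType R)
    (mu : {measure set (borel X) -> \bar R}) (k : ball_kind) (D : nat)
    (hmu : is_metric_measure mu)
    (hX : geometrically_doubling X k)
    (hD : is_doubling_constant X k D) :
  exists M : nat,
    [/\ is_max_net_card X k M,
        (M <= D)%N &
        forall s : R, 0 < s ->
          [/\ (op_norm mu 1 (averaging mu k s) <= M%:R%:E)%E,
              op_norm mu +oo%E (averaging mu k s) = 1%E &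
              forall p : R, 1 < p ->
                (op_norm mu p%:E (averaging mu k s)
                   <= (M%:R `^ p^-1)%:E)%E]].
Proof.
have [dD _] := hD.
have [M hM MD] := exists_max_net_card dD.
exists M; split=> // s s0; split.
- have := op_norm_averaging_le hX hmu s0 hM (lexx 1).
  by rewrite invr1 powRr1.
- exact: op_norm_averaging_oo.
- by move=> p p1; apply: op_norm_averaging_le => //; exact: ltW.
Qed.
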